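(* For the Sobolev space $W^{1,2}[0,1]$, the collection of symbols of densely defined multipliers is exactly $W^{1,2}[0,1]$: a function $\phi : [0,1] \to \mathbb{C}$ has the property that $D(M_\phi) = \{ f \in W^{1,2}[0,1] : \phi f \in W^{1,2}[0,1] \}$ is dense in $W^{1,2}[0,1]$ if and only if $\phi \in W^{1,2}[0,1]$. In particular, all the densely defined multipliers are bounded: for every such $\phi$, $D(M_\phi) = W^{1,2}[0,1]$ and $M_\phi : f \mapsto \phi f$ is a bounded operator on $W^{1,2}[0,1]$.
   Context: $W^{1,2}[0,1]$ denotes the set of functions $f : [0,1] \to \mathbb{C}$ that are absolutely continuous with $f' \in L^2[0,1]$ (actual functions, not equivalence classes), a Hilbert space with inner product $\langle f | g\rangle = \int_0^1 f(x)\overline{g(x)} + f'(x)\overline{g'(x)}\, dx$. For $\phi:[0,1]\to\mathbb{C}$, the multiplication operator $M_\phi f = \phi f$ has domain $D(M_\phi) = \{ f \in W^{1,2}[0,1] : \phi f \in W^{1,2}[0,1] \}$, where $\phi f$ is the pointwise product. The function $\phi$ is (the symbol of) a densely defined multiplier for $W^{1,2}[0,1]$ if $D(M_\phi)$ is dense in $W^{1,2}[0,1]$ in norm. *)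

(* Defs.v *)
From HB Require Import structures.
From mathcomp Require Import all_boot all_order all_algebra.
From mathcomp Require Import complex.
From mathcomp Require Import all_classical all_reals all_analysis.

Set Implicit Arguments.
Unset Strict Implicit.
Unset Printing Implicit Defensive.

Import Order.TTheory GRing.Theory Num.Theory.
Import numFieldNormedType.Exports.
Import ComplexField.Normc.

Local Open Scope classical_set_scope.
Local Open Scope ring_scope.
Local Open Scope complex_scope.

(* Functions [0, 1] -> C are represented by total functions R -> R[i]: W12 and
   W12_inner depend only on the values on [0, 1]. The derivatives at 0 and 1 do
   involve outside values, but {0, 1} is a null set. *)

Section Sobolev.
Variable R : realType.
Implicit Types f g phi : R -> R[i].

Local Notation mu := (@lebesgue_measure R).
Local Notation I01 := (`[0, 1]%classic : set R).

Definition absolutely_continuous01 f : Prop :=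
  forall e : R, 0 < e -> exists2 d : R, 0 < d &
    forall (n : nat) (a b : 'I_n -> R),
      (forall i, [/\ 0 <= a i, a i <= b i & b i <= 1]) ->
      trivIset setT (fun i => `]a i, b i[%classic) ->
      \sum_(i < n) (b i - a i) < d ->
      \sum_(i < n) normc (f (b i) - f (a i)) < e.

Definition derivablec f (x : R) : Prop :=
  derivable (fun t => complex.Re (f t)) x 1 /\
  derivable (fun t => complex.Im (f t)) x 1.

(* Total: the components take a default value where they are not derivable. *)
Definition derivc f (x : R) : R[i] :=
  derive1 (fun t => complex.Re (f t)) x +i* derive1 (fun t => complex.Im (f t)) x.

Definition L2_01 g : Prop :=
  [/\ measurable_fun I01 (fun x => complex.Re (g x)),
      measurable_fun I01 (fun x => complex.Im (g x)) &
      (\int[mu]_(x in I01) (normc (g x) ^+ 2)%:E < +oo)%E].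

(* The a.e. differentiability clause follows from absolute continuity (Lebesgue);
   it is spelled out so that derivc f is the derivative of f almost everywhere. *)
Definition W12 : set (R -> R[i]) := [set f |
  [/\ absolutely_continuous01 f,
      {ae mu, forall x, I01 x -> derivablec f x} &
      L2_01 (derivc f)]].

Definition Cintegral01 g : R[i] :=
  (\int[mu]_(x in I01) complex.Re (g x)) +i*
  (\int[mu]_(x in I01) complex.Im (g x)).

Definition W12_inner f g : R[i] :=
  Cintegral01 (fun x => f x * (g x)^* + derivc f x * (derivc g x)^*).

Definition W12_norm f : R := Num.sqrt (complex.Re (W12_inner f f)).

Definition multiplier_dom phi : set (R -> R[i]) :=
  [set f | W12 f /\ W12 (phi \* f)].

Definition densely_defined_multiplier phi : Prop :=
  forall f, W12 f -> forall e : R, 0 < e ->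
    exists2 g, multiplier_dom phi g & W12_norm (f \- g) < e.

End Sobolev.
Arguments W12 {R}.

(* Main.v *)
Require Import Defs.
From mathcomp Require Import all_boot all_order all_algebra.
From mathcomp Require Import complex ring lra.
From mathcomp Require Import all_classical all_reals all_analysis measurable_realfun.

Set Implicit Arguments.
Unset Strict Implicit.
Unset Printing Implicit Defensive.

Import Order.TTheory GRing.Theory Num.Theory.
Import numFieldNormedType.Exports.
Import ComplexField.Normc.

Local Open Scope classical_set_scope.
Local Open Scope ring_scope.
Local Open Scope complex_scope.

(** A function whose derivative is square integrable is controlled uniformly by
    its Sobolev norm, and this one estimate carries both directions.

    Write [E f] for the integral over [0, 1] of [|f|^2 + |f'|^2], the square of
    the norm.  The function [F = |f|^2] is absolutely continuous and satisfies
    [|F'| <= |f|^2 + |f'|^2] almost everywhere.  Comparing [F] with the primitive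
    of that bound ([le_increment_of_ae_derive1]) shows that [F] varies by at most
    [E f] on [0, 1]; as [F] is at most [E f] in mean, [|f x|^2 <= 2 * E f]
    for every [x] ([W12_sqr_normc_le]).

    If [phi] and [f] lie in the Sobolev space, the product rule and the uniform
    bound on both factors put [phi f] in the space, with
    [E (phi f) <= 8 * E phi * E f] ([W12M]).  So every symbol in the space has full
    domain and gives a bounded operator.

    Conversely, if the domain of [phi] is dense, it contains some [g] so close to
    the constant 1 in norm that the uniform bound forces [|g| >= 1/2] on [0, 1].
    Then [1/g] is in the space ([W12V]), hence so is [phi = (phi g) * (1/g)].

    The comparison of increments is the part of the fundamental theorem of calculus
    for absolutely continuous functions that is needed.  Almost every point
    has small intervals around it on which the increment of [F] is bounded through
    the derivative; the exceptional null set is covered by an open set of small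
    measure, on which absolute continuity makes the total increment small.  A
    supremum argument chains such intervals across [0, 1].

    A second point needing care is measurability: the square integrability of
    the derivative asks for Borel measurability of the total function [derive1],
    including its default value where the limit fails to exist, so an almost
    everywhere formula for the derivative is not enough.  It is proved once for
    all continuous functions in [measurable_derive1]. *)

(** * The modulus of a complex number *)

Section Modulus.
Variable R : realType.

Lemma sqr_normcE (z : R[i]) :
  normc z ^+ 2 = complex.Re z ^+ 2 + complex.Im z ^+ 2.
Proof. by case: z => a b /=; rewrite sqr_sqrtr// addr_ge0// sqr_ge0. Qed.

Lemma normc_ge0 (z : R[i]) : 0 <= normc z.
Proof. by case: z => a b; exact: sqrtr_ge0. Qed.

Lemma normr_Re_le (z : R[i]) : `|complex.Re z| <= normc z.
Proof.
rewrite -(@ler_pXn2r _ 2)// ?nnegrE ?normc_ge0// sqr_normcE real_normK ?num_real//.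
by rewrite lerDl sqr_ge0.
Qed.

Lemma normr_Im_le (z : R[i]) : `|complex.Im z| <= normc z.
Proof.
rewrite -(@ler_pXn2r _ 2)// ?nnegrE ?normc_ge0// sqr_normcE real_normK ?num_real//.
by rewrite lerDr sqr_ge0.
Qed.

Lemma normc_real (x : R) : normc x%:C = `|x|.
Proof. by rewrite /= expr0n addr0 sqrtr_sqr. Qed.

Lemma normc_conj (z : R[i]) : normc z^* = normc z.
Proof. by case: z => a b /=; rewrite sqrrN. Qed.

Lemma normc_distC (x y : R[i]) : normc (x - y) = normc (y - x).
Proof. by rewrite -normcN opprB. Qed.

Lemma normcB_le (x y : R[i]) : normc (x - y) <= normc x + normc y.
Proof. by rewrite -(normcN y) le_normcD. Qed.

Lemma normc_dist_le (x y : R[i]) : `|normc x - normc y| <= normc (x - y).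
Proof.
rewrite ler_norml; apply/andP; split.
  rewrite lerNl opprB lerBlDr.
  by have := le_normcD (y - x) x; rewrite subrK normc_distC.
by rewrite lerBlDr; have := le_normcD (x - y) y; rewrite subrK.
Qed.

End Modulus.

(** * Absolute continuity on the unit interval *)

Section AbsoluteContinuity.
Variable R : realType.
Implicit Types f g h : R -> R[i].
Local Notation I01 := (`[0, 1]%classic : set R).

(** Stability under differences, products, inverses and conjugation follows from this
    lemma: in each case the increments are bounded through those of the operands. *)
Lemma absolutely_continuous01_dominated (K : R) f g h :
  absolutely_continuous01 f -> absolutely_continuous01 g -> 0 < K ->
  (forall x y, 0 <= x <= 1 -> 0 <= y <= 1 ->
    normc (h y - h x) <= K * (normc (f y - f x) + normc (g y - g x))) ->
  absolutely_continuous01 h.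
Proof.
move=> cf cg K0 hK e e0.
have eK : 0 < e / (2 * K) by rewrite divr_gt0// mulr_gt0.
have [df df0 Hf] := cf _ eK; have [dg dg0 Hg] := cg _ eK.
exists (Num.min df dg); first by rewrite lt_min df0.
move=> n a b ab tab; rewrite lt_min => 
  /andP[/(Hf n a b ab tab) f1 /(Hg n a b ab tab) g1].
apply: (@le_lt_trans _ _ (\sum_(i < n) K * (normc (f (b i) - f (a i)) +
    normc (g (b i) - g (a i))))).
  apply: ler_sum => i _; have [a0 abi b1] := ab i; apply: hK.
    by rewrite a0 (le_trans abi).
  by rewrite b1 (le_trans a0).
rewrite -mulr_sumr big_split/= -ltr_pdivlMl//.
have -> : K^-1 * e = e / (2 * K) + e / (2 * K) by field; rewrite gt_eqF.
by rewrite ltrD.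
Qed.

Lemma absolutely_continuous01_cst (c : R[i]) : absolutely_continuous01 (fun=> c).
Proof.
move=> e e0; exists 1 => // n a b _ _ _.
by rewrite big1// => i _; rewrite subrr normc0.
Qed.

(** Real functions such as [Re f], [Im f] and [|f|] have increments no larger than
    those of [f], so they are all continuous on [0, 1]. *)
Lemma absolutely_continuous01_within f (u : R -> R) :
  absolutely_continuous01 f ->
  (forall x y, 0 <= x <= 1 -> 0 <= y <= 1 -> `|u y - u x| <= normc (f y - f x)) ->
  {within I01, continuous u}.
Proof.
move=> cf uf; apply/subspace_continuousP => x x01; apply/cvgrPdist_lt => e e0.
have [d d0 Hd] := cf _ e0.
have fd a b : 0 <= a -> a <= b -> b <= 1 -> b - a < d -> normc (f b - f a) < e.
  move=> a0 ab b1 bad; have := Hd 1%N (fun=> a) (fun=> b).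
  rewrite !big_ord1; apply=> //.
  by move=> i j _ _ _; rewrite (ord1 i) (ord1 j).
near=> y.
have y01 : I01 y by near: y; exact: withinT.
have xy : `|x - y| < d.
  near: y; apply: cvg_within; apply: (@cvgr_dist_lt _ _ _ (nbhs x)) => //.
move: x01 y01; rewrite /= !in_itv/= => x01 y01.
apply: le_lt_trans (uf y x y01 x01) _.
have /andP[x0 x1] := x01; have /andP[y0 y1] := y01.
have [yx|xy'] := leP y x.
  by apply: fd => //; rewrite -(ger0_norm (x := x - y))// subr_ge0.
rewrite normc_distC; apply: fd => //; first exact: ltW.
by rewrite -(ger0_norm (x := y - x)) 1?distrC// subr_ge0 ltW.
Unshelve. all: by end_near. Qed.

Lemma absolutely_continuous01_bounded f : absolutely_continuous01 f ->
  exists2 M : R, 0 < M & forall x, 0 <= x <= 1 -> normc (f x) <= M.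
Proof.
move=> cf.
have cn : {within I01, continuous (fun x => normc (f x))}.
  by apply: absolutely_continuous01_within cf _ => x y _ _; exact: normc_dist_le.
have [c _ Hc] := EVT_max ler01 cn.
exists (normc (f c) + 1); first by rewrite ltr_wpDl// normc_ge0.
by move=> x x01; rewrite ler_wpDr// Hc.
Qed.

Lemma absolutely_continuous01B f g : absolutely_continuous01 f ->
  absolutely_continuous01 g -> absolutely_continuous01 (f \- g).
Proof.
move=> cf cg; apply: (absolutely_continuous01_dominated cf cg ltr01) => x y _ _.
rewrite mul1r /= [X in normc X](_ : _ = f y - f x - (g y - g x)) ?normcB_le//.
ring.
Qed.

Lemma absolutely_continuous01M f g : absolutely_continuous01 f ->
  absolutely_continuous01 g -> absolutely_continuous01 (f \* g).
Proof.
move=> cf cg; have [Mf Mf0 fM] := absolutely_continuous01_bounded cf.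
have [Mg Mg0 gM] := absolutely_continuous01_bounded cg.
apply: (@absolutely_continuous01_dominated (Mf + Mg) _ _ _ cf cg).
  by rewrite addr_gt0.
move=> x y x01 y01 /=.
rewrite (_ : _ - _ = (f y - f x) * g y + f x * (g y - g x)); last by ring.
apply: le_trans (le_normcD _ _) _; rewrite !normcM mulrDr lerD//.
  by rewrite mulrC ler_wpM2r ?normc_ge0// (le_trans (gM _ y01))// lerDr ltW.
by rewrite ler_wpM2r ?normc_ge0// (le_trans (fM _ x01))// lerDl ltW.
Qed.

Lemma absolutely_continuous01V f (c : R) : absolutely_continuous01 f -> 0 < c ->
  (forall x, 0 <= x <= 1 -> c <= normc (f x)) ->
  absolutely_continuous01 (fun x => (f x)^-1).
Proof.
move=> cf c0 fc.
apply: (@absolutely_continuous01_dominated (c ^- 2) _ _ _ cf cf).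
  by rewrite invr_gt0 exprn_gt0.
have f0 x : 0 <= x <= 1 -> f x != 0.
  move=> /fc; apply: contraTN => /eqP ->.
  by rewrite normc0 -ltNge.
move=> x y x01 y01; have fx0 := f0 _ x01; have fy0 := f0 _ y01.
rewrite (_ : _ - _ = (f x - f y) / (f x * f y)); last first.
  by field; rewrite ?fx0 ?fy0.
rewrite normcM normcV normcM normc_distC mulrC.
apply: (@le_trans _ _ (c ^- 2 * normc (f y - f x))); last first.
  by rewrite ler_wpM2l ?invr_ge0 ?exprn_ge0 ?(ltW c0)// lerDl normc_ge0.
rewrite ler_wpM2r ?normc_ge0// lef_pV2 ?posrE ?exprn_gt0//.
  by rewrite expr2 ler_pM ?(ltW c0) ?fc.
by rewrite mulr_gt0// (lt_le_trans c0)// fc.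
Qed.

Lemma absolutely_continuous01_eq f g : (forall x, 0 <= x <= 1 -> f x = g x) ->
  absolutely_continuous01 f -> absolutely_continuous01 g.
Proof.
move=> fg cf; apply: (absolutely_continuous01_dominated cf cf ltr01) => x y x01 y01.
by rewrite mul1r !fg// lerDl normc_ge0.
Qed.

(** [|f|^2] is the product of [f] and its conjugate. *)
Lemma absolutely_continuous01_sqr_normc f : absolutely_continuous01 f ->
  absolutely_continuous01 (fun x => (normc (f x) ^+ 2)%:C).
Proof.
move=> cf; have cJ : absolutely_continuous01 (fun x => (f x)^*).
  apply: (absolutely_continuous01_dominated cf cf ltr01) => x y _ _.
  by rewrite mul1r -rmorphB normc_conj lerDl normc_ge0.
apply: absolutely_continuous01_eq (absolutely_continuous01M cf cJ) => x _ /=.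
rewrite sqr_normcE; case: (f x) => a b; apply/eqP; rewrite eq_complex /=.
by apply/andP; split; apply/eqP; ring.
Qed.

End AbsoluteContinuity.

(** * Differentiation of complex-valued functions *)

Section Derivc.
Variable R : realType.
Implicit Types f g h : R -> R[i].

Local Notation Re := complex.Re.
Local Notation Im := complex.Im.

Lemma ReB (x y : R[i]) : Re (x - y) = Re x - Re y.
Proof. by case: x y => a b [c d]. Qed.

Lemma ImB (x y : R[i]) : Im (x - y) = Im x - Im y.
Proof. by case: x y => a b [c d]. Qed.

Lemma ReM (x y : R[i]) : Re (x * y) = Re x * Re y - Im x * Im y.
Proof. by case: x y => a b [c d]. Qed.

Lemma ImM (x y : R[i]) : Im (x * y) = Re x * Im y + Im x * Re y.
Proof. by case: x y => a b [c d]. Qed.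

Lemma ReV (x : R[i]) : Re x^-1 = Re x * (Re x ^+ 2 + Im x ^+ 2)^-1.
Proof. by case: x. Qed.

Lemma ImV (x : R[i]) : Im x^-1 = - Im x * (Re x ^+ 2 + Im x ^+ 2)^-1.
Proof. by case: x => a b; rewrite mulNr. Qed.

Lemma derivable_subr (u v : R -> R) x : derivable u x 1 -> derivable v x 1 ->
  derivable (fun t => u t - v t) x 1 /\
  derive1 (fun t => u t - v t) x = derive1 u x - derive1 v x.
Proof.
move=> du dv; split; first exact: (@derivableB _ _ _ u v x 1 du dv).
by rewrite !derive1E; exact: (@deriveB _ _ _ u v x 1 du dv).
Qed.

Lemma derivable_addr (u v : R -> R) x : derivable u x 1 -> derivable v x 1 ->
  derivable (fun t => u t + v t) x 1 /\
  derive1 (fun t => u t + v t) x = derive1 u x + derive1 v x.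
Proof.
move=> du dv; split; first exact: (@derivableD _ _ _ u v x 1 du dv).
by rewrite !derive1E; exact: (@deriveD _ _ _ u v x 1 du dv).
Qed.

Lemma derivable_mulr (u v : R -> R) x : derivable u x 1 -> derivable v x 1 ->
  derivable (fun t => u t * v t) x 1 /\
  derive1 (fun t => u t * v t) x = u x * derive1 v x + v x * derive1 u x.
Proof.
move=> du dv; split; first exact: (@derivableM _ _ u v x 1 du dv).
by rewrite !derive1E; exact: (@deriveM _ _ u v x 1 du dv).
Qed.

Lemma derivablecB f g x : derivablec f x -> derivablec g x ->
  derivablec (f \- g) x /\ derivc (f \- g) x = derivc f x - derivc g x.
Proof.
move=> [f1 f2] [g1 g2].
have E1 : (fun t => Re ((f \- g) t)) = (fun t => Re (f t) - Re (g t)).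
  by apply/funext => t; exact: ReB.
have E2 : (fun t => Im ((f \- g) t)) = (fun t => Im (f t) - Im (g t)).
  by apply/funext => t; exact: ImB.
have [R1 R2] := derivable_subr f1 g1; have [I1 I2] := derivable_subr f2 g2.
rewrite /derivablec /derivc E1 E2 R2 I2; split; first by split; [exact: R1|exact: I1].
reflexivity.
Qed.

Lemma derivablecM f g x : derivablec f x -> derivablec g x ->
  derivablec (f \* g) x /\
  derivc (f \* g) x = derivc f x * g x + f x * derivc g x.
Proof.
move=> [f1 f2] [g1 g2].
have E1 : (fun t => Re ((f \* g) t)) =
    (fun t => Re (f t) * Re (g t) - Im (f t) * Im (g t)).
  by apply/funext => t; exact: ReM.
have E2 : (fun t => Im ((f \* g) t)) =
    (fun t => Re (f t) * Im (g t) + Im (f t) * Re (g t)).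
  by apply/funext => t; exact: ImM.
have [a1 a2] := derivable_mulr f1 g1; have [b1 b2] := derivable_mulr f2 g2.
have [c1 c2] := derivable_mulr f1 g2; have [d1 d2] := derivable_mulr f2 g1.
have [R1 R2] := derivable_subr a1 b1; have [I1 I2] := derivable_addr c1 d1.
rewrite /derivablec /derivc E1 E2 R2 I2 a2 b2 c2 d2.
split; first by split; [exact: R1|exact: I1].
case: (f x) (g x) => a b [c d] /=.
by apply/eqP; rewrite eq_complex /=; apply/andP; split; apply/eqP; ring.
Qed.

Lemma derivablecV f x : f x != 0 -> derivablec f x ->
  derivablec (fun t => (f t)^-1) x.
Proof.
move=> fx0 [f1 f2].
pose w t := Re (f t) * Re (f t) + Im (f t) * Im (f t).
have [a1 _] := derivable_mulr f1 f1; have [b1 _] := derivable_mulr f2 f2.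
have [dw _] : derivable w x 1 /\ _ := derivable_addr a1 b1.
have w0 : w x != 0.
  rewrite /w -!expr2 -sqr_normcE expf_neq0//; apply: contra_neq fx0.
  exact: eq0_normc.
have dwV : derivable (fun t => (w t)^-1) x 1 by exact: derivableV.
have E1 : (fun t => Re (f t)^-1) = (fun t => Re (f t) * (w t)^-1).
  by apply/funext => t; exact: ReV.
have E2 : (fun t => Im (f t)^-1) = (fun t => (-1 * Im (f t)) * (w t)^-1).
  by apply/funext => t; rewrite mulN1r; exact: ImV.
have [n1 _] := derivable_mulr (derivable_cst (-1 : R) x 1) f2.
have [R1 _] := derivable_mulr f1 dwV; have [I1 _] := derivable_mulr n1 dwV.
by rewrite /derivablec E1 E2; split; [exact: R1|exact: I1].
Qed.

Lemma near_eq_derivc f g x : {near x, f =1 g} -> derivablec f x ->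
  derivablec g x /\ derivc g x = derivc f x.
Proof.
move=> fg [f1 f2].
have E1 : {near x, (fun t => Re (f t)) =1 (fun t => Re (g t))}.
  by move: fg; apply: filterS => t ->.
have E2 : {near x, (fun t => Im (f t)) =1 (fun t => Im (g t))}.
  by move: fg; apply: filterS => t ->.
split; first by split; [exact: (near_eq_derivable E1 f1)|exact: (near_eq_derivable E2 f2)].
by rewrite /derivc !derive1E (near_eq_derive _ E1) (near_eq_derive _ E2).
Qed.

Lemma derivablec_cst (c : R[i]) x :
  derivablec (fun=> c) x /\ derivc (fun=> c) x = 0.
Proof.
split; first by split; exact: derivable_cst.
by rewrite /derivc !derive1E !derive_cst.
Qed.

End Derivc.

(** * Measurability of the derivative of a continuous function *)

Section DerivativeMeasurable.
Variable R : realType.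
Implicit Types (h u : R -> R) (x t : R).

Let diffq h t x := t^-1 * (h (t + x) - h x).

Lemma derivable_diffqE h x : derivable h x 1 = cvg (diffq h t x @[t --> 0^']).
Proof.
suff E : (fun t => t^-1 *: ((h \o shift x) (t *: 1) - h x)) = (diffq h)^~ x.
  by rewrite /derivable E.
by apply/funext => t; rewrite /diffq /= [t *: 1]mulr1.
Qed.

Lemma derivable_diffq_near h x e : derivable h x 1 -> 0 < e ->
  exists2 d : R, 0 < d & forall t, t != 0 -> `|t| < d ->
    `|derive1 h x - diffq h t x| < e.
Proof.
rewrite derivable_diffqE => dh e0.
have /cvgrPdist_lt/(_ _ e0)/nbhs_ballP[d /= d0 Hd] :
    diffq h t x @[t --> 0^'] --> derive1 h x by exact: dh.
exists d => // t t0 td; apply: Hd => //.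
by rewrite /ball/= sub0r normrN.
Qed.

Lemma diffq_continuous h t : continuous h -> continuous (diffq h t).
Proof.
move=> ch x; apply: cvgM; first exact: cvg_cst.
apply: cvgB; last exact: ch.
apply: (@continuous_comp _ _ _ (fun x => t + x) h); last exact: ch.
by apply: cvgD; [exact: cvg_cst|exact: cvg_id].
Qed.

Lemma diffq_step_continuous h x t : continuous h -> t != 0 ->
  {for t, continuous (fun s => diffq h s x)}.
Proof.
move=> ch t0; apply: cvgM; first exact: cvgV.
apply: cvgB; last exact: cvg_cst.
apply: (@continuous_comp _ _ _ (fun s => s + x) h); last exact: ch.
by apply: cvgD; [exact: cvg_id|exact: cvg_cst].
Qed.

Let small (m : nat) (t : R) : bool := (t != 0) && (`|t| < m.+1%:R^-1).

(** Cauchy's criterion for the difference quotients at [x].  Since the quotient is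
    continuous in a nonzero step, rational steps suffice, and the criterion
    becomes a countable combination of conditions closed in [x]. *)
Lemma derivable_diffqP h x : continuous h -> derivable h x 1 <->
  forall k, exists m, forall p q : rat, small m (ratr p) -> small m (ratr q) ->
    `|diffq h (ratr p) x - diffq h (ratr q) x| <= k.+1%:R^-1.
Proof.
move=> ch; split.
  move=> dh k; have k0 : 0 < (k.+1%:R^-1 : R) / 2 by rewrite divr_gt0.
  have [d d0 Hd] := derivable_diffq_near dh k0.
  have [m _ /(_ m (leqnn m)) md] := near_infty_natSinv_lt (PosNum d0).
  exists m => p q /andP[p0 pm] /andP[q0 qm].
  have Hp := Hd _ p0 (lt_trans pm md); have Hq := Hd _ q0 (lt_trans qm md).
  rewrite (splitr k.+1%:R^-1) ltW// (le_lt_trans (ler_distD (derive1 h x) _ _))//.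
  by rewrite ltrD// distrC.
move=> H; rewrite derivable_diffqE; apply/cauchy_cvgP; apply/cauchyP => _/posnumP[e].
have [k _ /(_ k (leqnn k)) ke] := near_infty_natSinv_lt e.
have [m Hm] := H k.
(* Any admissible rational step serves as a centre for the Cauchy filter. *)
pose q : rat := m.+2%:R^-1.
have qR : ratr q = m.+2%:R^-1 :> R by rewrite /q fmorphV/= ratr_nat.
have sq : small m (ratr q).
  rewrite /small qR invr_eq0 pnatr_eq0/= ger0_norm ?invr_ge0//.
  by rewrite ltf_pV2 ?posrE// ltr_nat.
exists (diffq h (ratr q) x); rewrite /= nbhs_simpl /=.
suff Hs t : small m t -> `|diffq h (ratr q) x - diffq h t x| <= k.+1%:R^-1.
  near=> t; apply: le_lt_trans ke; apply: Hs; rewrite /small.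
  apply/andP; split; first by near: t; exact: nbhs_dnbhs_neq.
  by near: t; apply: dnbhs0_lt.
move=> /andP[t0 tm]; rewrite leNgt; apply/negP => lt_k.
have cq : {for t, continuous (fun s => `|diffq h (ratr q) x - diffq h s x|)}.
  apply: cvg_norm; apply: cvgB; first exact: cvg_cst.
  exact: diffq_step_continuous.
have : \forall s \near t, small m s /\
    k.+1%:R^-1 < `|diffq h (ratr q) x - diffq h s x|.
  near=> s; split; last by near: s; exact: (cvgr_gt _ cq).
  apply/andP; split; first by near: s; exact: (cvgr_neq0 _ cvg_id).
  by near: s; apply: (cvgr_lt _ (cvg_norm cvg_id)).
move=> /nbhs_ballP[r /= r0 Hr].
have [p] : exists p : rat, ratr p \in `]t - r, t + r[.
  by have [p ?] := @rat_in_itvoo R (t - r) (t + r) ltac:(lra); exists p.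
rewrite in_itv/= => tpr.
have [sp] : small m (ratr p) /\
    k.+1%:R^-1 < `|diffq h (ratr q) x - diffq h (ratr p) x|.
  by apply: Hr; rewrite /ball/= ltr_distlC.
by rewrite ltNge Hm.
Unshelve. all: by end_near. Qed.

Lemma measurable_derivable h : continuous h -> measurable [set x | derivable h x 1].
Proof.
move=> ch.
have -> : [set x | derivable h x 1] = \bigcap_k \bigcup_m
    ~` (\bigcup_(p : rat) \bigcup_(q : rat)
    ([set x | small m (ratr p) && small m (ratr q) /\
       k.+1%:R^-1 < `|diffq h (ratr p) x - diffq h (ratr q) x|])).
  apply/seteqP; split => x /=.
    move=> /(derivable_diffqP x ch) H k _; have [m Hm] := H k.
    by exists m => // -[p _ [q _ [/andP[sp sq]]]]; rewrite ltNge Hm.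
  move=> H; apply/(derivable_diffqP x ch) => k.
  have [m _ Hm] := H k Logic.I; exists m => p q sp sq.
  rewrite leNgt; apply/negP => kpq; apply: Hm.
  by exists p => //; exists q => //; rewrite sp sq.
apply: bigcapT_measurable => k; apply: bigcupT_measurable => m.
apply: measurableC; apply: bigcupT_measurable_rat => p.
apply: bigcupT_measurable_rat => q.
case: (small m (ratr p) && small m (ratr q)); last first.
  by rewrite (_ : mkset _ = set0)//; apply/seteqP; split => x //= -[].
rewrite (_ : mkset _ =
    [set x | k.+1%:R^-1 < `|diffq h (ratr p) x - diffq h (ratr q) x|]); last first.
  by apply/seteqP; split => x /= => [[]|].
apply: open_measurable.
have := @open_gt R k.+1%:R^-1.
move=> /(@open_comp _ _ (fun x => `|diffq h (ratr p) x - diffq h (ratr q) x|)); apply.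
move=> x _; apply: cvg_norm; apply: cvgB; exact: diffq_continuous.
Qed.

(** On the Borel set where [h] is derivable, the derivative is the limit of the
    continuous quotients with steps [1/(n+1)]; elsewhere [derive1] takes the default
    value of [lim], which is 0. *)
Lemma measurable_derive1 h : continuous h -> measurable_fun setT (derive1 h).
Proof.
move=> ch; pose D := [set x | derivable h x 1].
have mD : measurable D by exact: measurable_derivable.
have -> : derive1 h = derive1 h \_ D.
  apply/funext => x; rewrite patchE; case: ifPn => //.
  rewrite notin_setE /D /= derivable_diffqE => /dvgP dh.
  exact: dh.
apply: (measurable_restrictT (derive1 h) mD).1.
apply: (@measurable_fun_cvg _ _ _ _ (fun n x => diffq h n.+1%:R^-1 x)).
  move=> n; apply: measurable_funTS; apply: continuous_measurable_fun.
  exact: diffq_continuous.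
move=> x Dx; apply/cvgrPdist_lt => e e0.
have [d d0 Hd] := derivable_diffq_near Dx e0.
near=> n; apply: Hd; first by rewrite invr_eq0.
rewrite ger0_norm ?invr_ge0//; near: n.
exact: (near_infty_natSinv_lt (PosNum d0)).
Unshelve. all: by end_near. Qed.

(** Precomposing with the projection onto [0, 1] gives a function continuous on
    the whole line with the same derivative inside; the two endpoints are
    measurable singletons. *)
Lemma measurable_derive1_01 u : {within `[0, 1], continuous u} ->
  measurable_fun (`[0, 1] : set R) (derive1 u).
Proof.
move=> cu; pose clamp x := Num.max 0 (Num.min 1 x).
have clamp01 x : clamp x \in `[0, 1].
  by rewrite in_itv/= /clamp le_max lexx ge_max ler01 ge_min lexx.
have clampE x : 0 <= x <= 1 -> clamp x = x.
  by move=> /andP[x0 x1]; rewrite /clamp (min_idPr x1) (max_idPr x0).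
have cc : continuous clamp.
  move=> x; apply: continuous_max; first exact: cvg_cst.
  by apply: continuous_min; [exact: cvg_cst|exact: cvg_id].
have ch : continuous (u \o clamp).
  move=> x; have /(_ _ (clamp01 x)) := (@subspace_continuousP _ _ _ _).1 cu.
  move=> cux; apply: (@cvg_comp _ _ _ clamp u _ _ _ _ cux).
  move=> A HA; have {}HA : \forall y \near x, `[0, 1]%classic (clamp y) -> A (clamp y).
    exact: (cc x _ HA).
  suff : \forall y \near x, A (clamp y) by [].
  by apply: filterS HA => y; apply; exact: clamp01.
have mh : measurable_fun (`]0, 1[ : set R) (derive1 u).
  apply: (@eq_measurable_fun _ _ _ _ _ (derive1 (u \o clamp))).
    move=> x; rewrite inE /= => x01; rewrite !derive1E; apply: near_eq_derive.
    near=> y; rewrite /= clampE//.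
    have : y \in `]0, 1[ by near: y; exact: near_in_itvoo.
    by rewrite in_itv/= => /andP[y0 y1]; rewrite !ltW.
  apply: measurable_funTS; exact: measurable_derive1.
exact: (measurable_fun_itv_cc mh).
Unshelve. all: by end_near. Qed.

End DerivativeMeasurable.

(** * Comparing increments through derivatives almost everywhere *)

Section GrowthComparison.
Variable R : realType.
Local Notation mu := (@lebesgue_measure R).
Local Notation I01 := (`[0, 1]%classic : set R).
Implicit Types (F G h : R -> R).

(** The classical straddle lemma: intervals must contain the point [c], but need
    not have it as an endpoint. *)
Lemma derivable_straddle h (c e : R) : derivable h c 1 -> 0 < e ->
  exists2 d : R, 0 < d & forall x y, c - d < x -> x <= c -> c <= y -> y < c + d ->
    `|h y - h x - derive1 h c * (y - x)| <= e * (y - x).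
Proof.
move=> dh e0; have [d d0 Hd] := derivable_diffq_near dh e0.
exists d => // x y dx xc cy yd.
have one z : `|z - c| < d -> `|h z - h c - derive1 h c * (z - c)| <= e * `|z - c|.
  move=> zd; have [->|zc] := eqVneq z c; first by rewrite !subrr mulr0 subrr normr0 mulr0.
  have zc0 : z - c != 0 by rewrite subr_eq0.
  have := ltW (Hd _ zc0 zd); rewrite subrK => qe.
  have -> : h z - h c - derive1 h c * (z - c) =
      - (derive1 h c - (z - c)^-1 * (h z - h c)) * (z - c) by field.
  by rewrite normrM normrN ler_wpM2r.
have Hy : `|y - c| < d by rewrite ger0_norm ?subr_ge0//; lra.
have Hx : `|x - c| < d by rewrite ler0_norm ?subr_le0//; lra.
have -> : h y - h x - derive1 h c * (y - x) =
  (h y - h c - derive1 h c * (y - c)) - (h x - h c - derive1 h c * (x - c)) by ring.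
have -> : e * (y - x) = e * `|y - c| + e * `|x - c|.
  by rewrite ger0_norm ?subr_ge0// ler0_norm ?subr_le0//; ring.
by rewrite (le_trans (ler_normB _ _))// lerD// one.
Qed.

(** Finitely many intervals inside [U] in increasing order.  The endpoints are
    sequences on [nat], of which only the first [n] terms count, so that appending an
    interval does not change the index type. *)
Definition interval_chain (U : set R) (s t : R) (n : nat) (a b : nat -> R) :=
  [/\ forall i, (i < n)%N -> [/\ s <= a i, a i <= b i & b i <= t],
      forall i j, (i < j)%N -> (j < n)%N -> b i <= a j &
      forall i, (i < n)%N -> `]a i, b i[%classic `<=` U].

Lemma interval_chain_rcons U s x y n a b : s <= x -> x <= y ->
  `]x, y[%classic `<=` U -> interval_chain U s x n a b ->
  interval_chain U s y n.+1 (fun i => if i == n then x else a i)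
                   (fun i => if i == n then y else b i).
Proof.
move=> sx xy xyU [Hab Hsep HU]; split => [i|i j|i].
- rewrite ltnS leq_eqVlt; case: eqP => [->//|_ /= /Hab[sa ab bx]]; split => //.
  exact: le_trans xy.
- rewrite ltnS => ij jn; rewrite (ltn_eqF (leq_trans ij jn)).
  have [_|jn'] := eqVneq j n; first by have [] := Hab _ (leq_trans ij jn).
  by apply: Hsep => //; rewrite ltn_neqAle jn'.
- by rewrite ltnS leq_eqVlt; case: eqP => //= _; exact: HU.
Qed.

Lemma interval_chain_trivIset U s t n a b : interval_chain U s t n a b ->
  trivIset setT (fun i : 'I_n => `]a i, b i[%classic).
Proof.
move=> [_ Hsep _] i j _ _ [z [/=]]; rewrite !in_itv/= => /andP[az zb] /andP[az' zb'].
apply/val_inj; case: (ltngtP i j) => // ij.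
  by have := Hsep _ _ ij (ltn_ord j); rewrite leNgt (lt_trans az').
by have := Hsep _ _ ij (ltn_ord i); rewrite leNgt (lt_trans az).
Qed.

Lemma interval_chain_length_le U s t n a b : open U -> interval_chain U s t n a b ->
  ((\sum_(i < n) (b i - a i))%:E <= mu U)%E.
Proof.
move=> oU ch; have [Hab _ HU] := ch; have mU := open_measurable oU.
have tab := interval_chain_trivIset ch.
have -> : ((\sum_(i < n) (b i - a i))%:E = mu (\big[setU/set0]_(i < n) `]a i, b i[%classic))%E.
  rewrite measure_bigsetU_ord//= -sumEFin; apply: eq_bigr => i _.
  have [_ ab _] := Hab _ (ltn_ord i).
  rewrite lebesgue_measure_itv/= lte_fin; case: ltP => //.
  by move=> ba; rewrite (@le_anti _ _ (a i) (b i)) ?subrr// ab ba.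
apply: le_measure; rewrite ?inE//; first exact: bigsetU_measurable.
rewrite -(bigcup_mkord n (fun i => `]a i, b i[%classic)) => z [k kn Hz].
exact: HU Hz.
Qed.

(** On the intervals covering the exceptional null set the increments of [G] are
    nonnegative by monotonicity, so it suffices that absolute continuity makes
    those of [F] small.  Elsewhere the derivatives compare the increments. *)
Lemma le_increment_of_ae_derive1 F G (s t : R) :
  absolutely_continuous01 (fun x => (F x)%:C) ->
  {homo G : x y / x <= y} ->
  {ae mu, forall x, I01 x ->
    [/\ derivable F x 1, derivable G x 1 & derive1 F x <= derive1 G x]} ->
  0 <= s -> s <= t -> t <= 1 -> F t - F s <= G t - G s.
Proof.
move=> acF ndG [N [mN N0 HN]] s0 st t1.
(* One [e] pays for the straddle errors, the other for the exceptional set. *)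
suff key e : 0 < e -> F t - F s <= G t - G s + e * (t - s) + e.
  apply/ler_addgt0Pr => e e0; have e20 : 0 < e / 2 by rewrite divr_gt0.
  apply: le_trans (key _ e20) _; rewrite -addrA lerD2l [leRHS]splitr lerD2r.
  by rewrite -[leRHS]mulr1 ler_wpM2l ?(ltW e20)//; lra.
move=> e0; have [d d0 acd] := acF _ e0.
have N_fin : (mu N < +oo)%E by rewrite N0.
have [U [oU NU UN]] := lebesgue_regularity_outer mN N_fin d0.
have mU := open_measurable oU.
have Ud : (mu U < d%:E)%E.
  have mUN : measurable (U `\` N) by exact: measurableD.
  have : (mu (N `|` (U `\` N)) <= mu N + mu (U `\` N))%E by exact: measureU2.
  by rewrite setDUK// N0 add0e => /le_lt_trans; apply.
(* The sum records the increments of [F] across the part of [U] used so far;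
   absolute continuity bounds it by [e] in the end. *)
pose P x := exists n a b, interval_chain U s x n a b /\
  F x - F s <= G x - G s + e * (x - s) + \sum_(i < n) `|F (b i) - F (a i)|.
suff [n [a [b [ch]]]] : P t.
  move=> /le_trans; apply; rewrite lerD2l.
  have [Hab _ _] := ch.
  have -> : \sum_(i < n) `|F (b i) - F (a i)| =
      \sum_(i < n) normc ((F (b i))%:C - (F (a i))%:C).
    by apply: eq_bigr => i _; rewrite -rmorphB normc_real.
  apply/ltW; apply: (acd n (fun i => a i) (fun i => b i)).
  - move=> i; have [? ? ?] := Hab _ (ltn_ord i).
    by split => //; [exact: le_trans s0 _|apply: le_trans t1].
  - exact: interval_chain_trivIset ch.
  - by rewrite -lte_fin (le_lt_trans (interval_chain_length_le oU ch)).
(* Property [P] crosses any point [c]: by appending an interval of [U] when [c]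
   is exceptional, by the derivatives at [c] otherwise. *)
have step c : s <= c <= t -> exists2 r : R, 0 < r & forall x y, s <= x -> y <= t ->
    c - r < x -> x <= c -> c <= y -> y < c + r -> P x -> P y.
  move=> /andP[sc ct]; have [cN|cN] := pselect (N c).
    have /nbhs_ballP[r /= r0 cr] : nbhs c U.
      by apply: open_nbhs_nbhs; split => //; exact: NU.
    exists r => // x y sx yt rx xc cy yr [n [a [b [ch HF]]]].
    have xy := le_trans xc cy.
    exists n.+1, (fun i => if i == n then x else a i),
      (fun i => if i == n then y else b i).
    split.
      apply: interval_chain_rcons => // z; rewrite /= in_itv/= => /andP[xz zy].
      by apply: cr; rewrite /ball/= ltr_distlC; apply/andP; split; lra.
    rewrite big_ord_recr/= eqxx.
    under eq_bigr do rewrite ltn_eqF//.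
    have Gxy : G x <= G y by exact: ndG.
    have := ler_norm (F y - F x); have : 0 <= e * (y - x) by rewrite mulr_ge0 ?subr_ge0// ltW.
    lra.
  have [dF dG FG] : [/\ derivable F c 1, derivable G c 1 & derive1 F c <= derive1 G c].
    apply: contrapT => H; apply: cN; apply: HN => /= /(_ _)/H; apply.
    by rewrite /= in_itv/= (le_trans s0)// (le_trans ct).
  have e20 : 0 < e / 2 by rewrite divr_gt0.
  have [r1 r10 H1] := derivable_straddle dF e20.
  have [r2 r20 H2] := derivable_straddle dG e20.
  exists (Num.min r1 r2); first by rewrite lt_min r10.
  move=> x y sx yt rx xc cy yr [n [a [b [[Hab Hsep HU] HF]]]].
  have xy := le_trans xc cy.
  exists n, a, b; split.
    by split => // i /Hab[? ? bx]; split => //; exact: le_trans xy.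
  have [m1 m2] : Num.min r1 r2 <= r1 /\ Num.min r1 r2 <= r2 by rewrite !ge_min !lexx orbT.
  have := H1 x y ltac:(lra) xc cy ltac:(lra); have := H2 x y ltac:(lra) xc cy ltac:(lra).
  rewrite !ler_norml => /andP[G1 _] /andP[_ F1].
  have : derive1 F c * (y - x) <= derive1 G c * (y - x) by rewrite ler_wpM2r// subr_ge0.
  lra.
pose S := [set x | s <= x <= t /\ P x].
have Ss : S s.
  split; first by rewrite lexx.
  exists 0%N, (fun=> s), (fun=> s); split; first by split.
  by rewrite big_ord0 !subrr mulr0 !addr0.
have hS : has_sup S by split; [exists s|exists t => x [/andP[]]].
have Sle x : S x -> x <= sup S by exact: (sup_upper_bound hS).
have sc : s <= sup S by exact: Sle.
have ct : sup S <= t by apply: ge_sup; [exists s|move=> x [/andP[]]].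
have [|r r0 Hr] := step (sup S); first by rewrite sc.
have [x [/andP[sx xt] Px] rx] := sup_adherent r0 hS.
have xc : x <= sup S by apply: Sle; split; rewrite ?sx.
(* The step at the supremum reaches beyond it unless it is already [t]. *)
pose y := Num.min t (sup S + r / 2).
have Py : P y.
  apply: (Hr x) => //; rewrite /y; first by rewrite ge_min lexx.
    by rewrite le_min ct lerDl divr_ge0// ltW.
  by rewrite gt_min; apply/orP; right; lra.
have : y <= sup S.
  apply: Sle; split => //.
  by rewrite /y ge_min lexx le_min st/= andbT (le_trans sc)// lerDl divr_ge0// ltW.
have : y = t \/ y = sup S + r / 2 by rewrite /y; case: leP; [left|right].
by case=> [<- //|->]; lra.
Qed.

End GrowthComparison.

(** * Integration on the unit interval *)

Section Integration.
Variable R : realType.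
Local Notation mu := (@lebesgue_measure R).
Local Notation I01 := (`[0, 1]%classic : set R).
Implicit Types (u w : R -> R).

Lemma lebesgue_measure01 : mu I01 = 1%E.
Proof. by rewrite lebesgue_measure_itv/= lte_fin ltr01 -EFinB subr0. Qed.

Lemma ae_imply (P Q : R -> Prop) : (forall x, P x -> Q x) ->
  {ae mu, forall x, P x} -> {ae mu, forall x, Q x}.
Proof. by apply: filterS; exact: (ae_filter_ringOfSetsType mu). Qed.

Lemma ae_imply2 (P Q S : R -> Prop) : (forall x, P x -> Q x -> S x) ->
  {ae mu, forall x, P x} -> {ae mu, forall x, Q x} -> {ae mu, forall x, S x}.
Proof. by apply: filterS2; exact: (ae_filter_ringOfSetsType mu). Qed.

Lemma ae_interior01 : {ae mu, forall x, I01 x -> 0 < x < 1}.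
Proof.
exists ([set 0] `|` [set 1]); split; first exact: measurableU.
  have : (mu ([set 0%R] `|` [set 1%R]) <= mu [set 0%R] + mu [set 1%R])%E by exact: measureU2.
  by rewrite !lebesgue_measure_set1 adde0 measure_le0 => /eqP.
move=> x /= /not_implyP[]; rewrite in_itv/= => /andP[x0 x1] /negP.
rewrite negb_and -!leNgt => /orP[x0'|x1']; [left|right]; apply: le_anti.
  by rewrite x0 x0'.
by rewrite x1 x1'.
Qed.

Lemma integrable01_cst (k : R) : mu.-integrable I01 (EFin \o (fun=> k)).
Proof.
apply/integrableP; split; first exact/measurable_EFinP.
rewrite [X in (X < _)%E](_ : _ = \int[mu]_(x in I01) (cst `|k|%:E x))%E//.
by rewrite integral_cst// [X in (_ * X)%E]lebesgue_measure01 mule1 ltry.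
Qed.

Lemma integrable01_ae_bound u w : measurable_fun I01 u ->
  (forall x, I01 x -> 0 <= u x) -> (forall x, I01 x -> 0 <= w x) ->
  {ae mu, forall x, I01 x -> u x <= w x} ->
  mu.-integrable I01 (EFin \o w) ->
  mu.-integrable I01 (EFin \o u) /\
  \int[mu]_(x in I01) u x <= \int[mu]_(x in I01) w x.
Proof.
move=> mu_ u0 w0 uw /integrableP[mw woo].
have mue : measurable_fun I01 (EFin \o u) by exact/measurable_EFinP.
have le_int : (\int[mu]_(x in I01) (u x)%:E <= \int[mu]_(x in I01) (w x)%:E)%E.
  apply: ae_ge0_le_integral => //.
have abs_int v : (forall x, I01 x -> 0 <= v x) ->
    (\int[mu]_(x in I01) `|(EFin \o v) x| = \int[mu]_(x in I01) (v x)%:E)%E.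
  move=> v0; apply: eq_integral => x; rewrite inE => Ix.
  by rewrite /= ger0_norm// v0.
have iu : mu.-integrable I01 (EFin \o u).
  apply/integrableP; split => //.
  by rewrite abs_int// (le_lt_trans le_int)// -abs_int.
split => //; apply: fine_le => //; apply: integrable_fin_num => //.
exact/integrableP.
Qed.

Lemma integrable01D u w : mu.-integrable I01 (EFin \o u) ->
  mu.-integrable I01 (EFin \o w) ->
  mu.-integrable I01 (EFin \o (fun x => u x + w x)).
Proof. by move=> iu iw; apply: (integrableD _ iu iw). Qed.

Lemma integrable01Z (k : R) u : mu.-integrable I01 (EFin \o u) ->
  mu.-integrable I01 (EFin \o (fun x => k * u x)).
Proof. by move=> iu; apply: (integrableZl _ k iu). Qed.

Lemma ge0_subset_Rintegral (A B : set R) w : measurable A -> measurable B ->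
  A `<=` B -> (forall x, 0 <= w x) -> mu.-integrable B (EFin \o w) ->
  \int[mu]_(x in A) w x <= \int[mu]_(x in B) w x.
Proof.
move=> mA mB AB w0 iw; apply: fine_le.
- by apply: integrable_fin_num => //; exact: integrableS iw.
- exact: integrable_fin_num.
- by apply: ge0_subset_integral => //; [case/integrableP: iw|move=> x _; rewrite lee_fin].
Qed.

End Integration.

(** * The energy and the uniform bound *)

Section Energy.
Variable R : realType.
Local Notation mu := (@lebesgue_measure R).
Local Notation I01 := (`[0, 1]%classic : set R).
Local Notation Re := complex.Re.
Local Notation Im := complex.Im.
Implicit Types (f g h : R -> R[i]).

Definition W12_density f x : R := normc (f x) ^+ 2 + normc (derivc f x) ^+ 2.

Definition W12_energy f : R := \int[mu]_(x in I01) W12_density f x.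

Lemma W12_density_ge0 f x : 0 <= W12_density f x.
Proof. by rewrite addr_ge0// sqr_ge0. Qed.

Lemma W12_energy_ge0 f : 0 <= W12_energy f.
Proof. by apply: Rintegral_ge0 => x _; exact: W12_density_ge0. Qed.

Lemma sqr_normc_le_density f x : normc (f x) ^+ 2 <= W12_density f x.
Proof. by rewrite lerDl sqr_ge0. Qed.

Lemma sqr_normc_derivc_le_density f x : normc (derivc f x) ^+ 2 <= W12_density f x.
Proof. by rewrite lerDr sqr_ge0. Qed.

Lemma W12_normE f : W12_norm f = Num.sqrt (W12_energy f).
Proof.
congr Num.sqrt; apply: eq_Rintegral => x _; rewrite /W12_density.
rewrite (sqr_normcE (f x)) (sqr_normcE (derivc f x)); by case: (f x) (derivc f x) => a b [c d] /=; ring.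
Qed.

Lemma continuous_Re f : absolutely_continuous01 f ->
  {within I01, continuous (fun x => Re (f x))}.
Proof.
by move=> /absolutely_continuous01_within; apply => x y _ _; rewrite -ReB normr_Re_le.
Qed.

Lemma continuous_Im f : absolutely_continuous01 f ->
  {within I01, continuous (fun x => Im (f x))}.
Proof.
by move=> /absolutely_continuous01_within; apply => x y _ _; rewrite -ImB normr_Im_le.
Qed.

Lemma measurable_sqr_normc g : measurable_fun I01 (fun x => Re (g x)) ->
  measurable_fun I01 (fun x => Im (g x)) ->
  measurable_fun I01 (fun x => normc (g x) ^+ 2).
Proof.
move=> m1 m2.
rewrite (_ : (fun x => _) = (fun x => Re (g x) ^+ 2 + Im (g x) ^+ 2)); last first.
  by apply/funext => x; exact: sqr_normcE.
by apply: measurable_funD; exact: measurable_funX.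
Qed.

Lemma measurable_Re_derivc f : absolutely_continuous01 f ->
  measurable_fun I01 (fun x => Re (derivc f x)).
Proof. by move=> cf; apply: measurable_derive1_01; exact: continuous_Re. Qed.

Lemma measurable_Im_derivc f : absolutely_continuous01 f ->
  measurable_fun I01 (fun x => Im (derivc f x)).
Proof. by move=> cf; apply: measurable_derive1_01; exact: continuous_Im. Qed.

Lemma integrable_sqr_normc f : absolutely_continuous01 f ->
  mu.-integrable I01 (EFin \o (fun x => normc (f x) ^+ 2)).
Proof.
move=> cf; have [M M0 fM] := absolutely_continuous01_bounded cf.
have mf : measurable_fun I01 (fun x => normc (f x) ^+ 2).
  apply: measurable_sqr_normc; apply: subspace_continuous_measurable_fun => //.
    exact: continuous_Re.
  exact: continuous_Im.
have [] := @integrable01_ae_bound R _ (fun=> M ^+ 2) mf _ _ _ (integrable01_cst _) => //.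
- by move=> x _; exact: sqr_ge0.
- by move=> x _; exact: sqr_ge0.
- apply: aeW => x; rewrite /= in_itv/= => x01.
  by rewrite ler_pXn2r ?nnegrE ?normc_ge0 ?(ltW M0)// fM.
Qed.

Lemma W12_density_integrable f : W12 f -> mu.-integrable I01 (EFin \o W12_density f).
Proof.
move=> [cf _ [m1 m2 foo]]; apply: integrable01D; first exact: integrable_sqr_normc.
have mN := measurable_sqr_normc m1 m2.
apply/integrableP; split; first exact/measurable_EFinP.
apply: le_lt_trans foo; apply: ge0_le_integral => //.
- by apply/measurable_EFinP; exact: measurableT_comp.
- exact/measurable_EFinP.
- by move=> x _; rewrite abse_EFin lee_fin ger0_norm// sqr_ge0.
Qed.

(** Absolute continuity already makes the components of the derivative measurable,
    so membership in the Sobolev space reduces to a pointwise bound by an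
    integrable function, wherever the derivative exists. *)
Lemma W12_dominated h (w : R -> R) : absolutely_continuous01 h ->
  mu.-integrable I01 (EFin \o w) -> (forall x, I01 x -> 0 <= w x) ->
  {ae mu, forall x, I01 x -> derivablec h x /\ normc (derivc h x) ^+ 2 <= w x} ->
  W12 h.
Proof.
move=> ch iw w0 hw.
have m1 := measurable_Re_derivc ch; have m2 := measurable_Im_derivc ch.
split => //.
  by apply: ae_imply hw => x hx /hx[].
split => //.
have mN := measurable_sqr_normc m1 m2.
have [] := @integrable01_ae_bound R _ w mN _ _ _ iw => //.
- by move=> x _; exact: sqr_ge0.
- by apply: ae_imply hw => x hx /hx[].
move=> /integrableP[_ +] _; apply: le_lt_trans.
apply: ge0_le_integral => //.
- by move=> x _; rewrite lee_fin sqr_ge0.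
- exact/measurable_EFinP.
- by apply/measurable_EFinP; exact: measurableT_comp.
- by move=> x _; rewrite abse_EFin lee_fin ler_norm.
Qed.

(** [F = |f|^2] has [|F'| = 2 |Re f Re f' + Im f Im f'|], at most the density
    by the inequality between arithmetic and geometric means.  Comparing [F] and
    [-F] with the primitive of the density bounds the increment of [F] on both
    sides. *)
Lemma W12_sqr_normc_increment f s t : W12 f -> 0 <= s -> s <= t -> t <= 1 ->
  `|normc (f t) ^+ 2 - normc (f s) ^+ 2| <= W12_energy f.
Proof.
move=> Wf s0 st t1; have [cf df _] := Wf; have iw := W12_density_integrable Wf.
pose w := W12_density f \_ I01.
have w0 x : 0 <= w x.
  by rewrite /w patchE; case: ifPn => // _; exact: W12_density_ge0.
have iwT : mu.-integrable setT (EFin \o w).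
  by move: (iw); rewrite integrable_mkcond// restrict_EFin.
pose G (x : R) : R := \int[mu]_(y in `]-oo, x]) w y.
have ndG : {homo G : x y / x <= y}.
  move=> x y xy; apply: ge0_subset_Rintegral => //.
    by apply: subset_itvl; rewrite bnd_simp.
  exact: integrableS iwT.
have G0 x : 0 <= G x by apply: Rintegral_ge0.
have GE x : G x <= W12_energy f.
  rewrite /W12_energy Rintegral_mkcond; exact: ge0_subset_Rintegral.
have dG : {ae mu, forall x, derivable G x 1 /\ derive1 G x = w x}.
  apply: FTC1Ny; first by move=> y; exact: integrableS iwT.
  exact: integrable_locally.
pose F x := normc (f x) ^+ 2.
have dF x : derivablec f x -> derivable F x 1 /\ `|derive1 F x| <= W12_density f x.
  move=> [f1 f2].
  have -> : F = (fun t => Re (f t) * Re (f t) + Im (f t) * Im (f t)).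
    by apply/funext => y; rewrite /F (sqr_normcE (f y)) !expr2.
  have [a1 a2] := derivable_mulr f1 f1; have [b1 b2] := derivable_mulr f2 f2.
  have [D1 D2] := derivable_addr a1 b1.
  split; first exact: D1.
  rewrite D2 a2 b2 /W12_density (sqr_normcE (f x)) (sqr_normcE (derivc f x)) /=.
  set a := Re (f x); set b := Im (f x); set c := derive1 _ x; set d := derive1 _ x.
  have := sqr_ge0 (a - c); have := sqr_ge0 (a + c).
  have := sqr_ge0 (b - d); have := sqr_ge0 (b + d).
  by move=> h1 h2 h3 h4; rewrite ler_norml; apply/andP; split; nra.
have cF : absolutely_continuous01 (fun x => (F x)%:C).
  exact: absolutely_continuous01_sqr_normc.
have cNF : absolutely_continuous01 (fun x => (0 - F x)%:C).
  apply: (absolutely_continuous01_dominated cF cF ltr01) => x y _ _.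
  rewrite mul1r -!rmorphB !normc_real.
  have -> : 0 - F y - (0 - F x) = - (F y - F x) by ring.
  by rewrite normrN lerDl.
have aeFG : {ae mu, forall x, I01 x -> [/\ derivable F x 1, derivable G x 1,
    derive1 F x <= derive1 G x & derive1 (fun y => 0 - F y) x <= derive1 G x]}.
  apply: ae_imply2 df dG => x dfx [dGx ->] Ix.
  have [dFx] := dF _ (dfx Ix); rewrite ler_norml => /andP[F1 F2].
  rewrite /w patchE mem_set//; split => //.
  have [_ ->] := derivable_subr (derivable_cst (0 : R) x 1) dFx.
  by rewrite derive1_cst sub0r lerNl.
rewrite ler_norml; apply/andP; split.
  suff : (0 - F t) - (0 - F s) <= G t - G s by have := G0 s; have := GE t; rewrite /F; lra.
  apply: (@le_increment_of_ae_derive1 R (fun y => 0 - F y) G s t) => //.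
  apply: ae_imply aeFG => x H /H[dFx dGx _ ?]; split => //.
  by have [] := derivable_subr (derivable_cst (0 : R) x 1) dFx.
suff : F t - F s <= G t - G s by have := G0 s; have := GE t; rewrite /F; lra.
by apply: (@le_increment_of_ae_derive1 R F G s t) => //;
  apply: ae_imply aeFG => x H /H[].
Qed.

(** Somewhere [|f|^2] is at most its mean, which is at most the energy, and it
    varies by at most the energy; instead of choosing such a point, the inequality
    is integrated over it. *)
Lemma W12_sqr_normc_le f x : W12 f -> 0 <= x <= 1 ->
  normc (f x) ^+ 2 <= 2 * W12_energy f.
Proof.
move=> Wf /andP[x0 x1]; have iw := W12_density_integrable Wf.
have H y : I01 y -> normc (f x) ^+ 2 - W12_energy f <= W12_density f y.
  rewrite /= in_itv/= => /andP[y0 y1]; apply: le_trans (sqr_normc_le_density f y).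
  have [xy|/ltW yx] := leP x y.
    by have := W12_sqr_normc_increment Wf x0 xy y1; rewrite ler_norml; lra.
  by have := W12_sqr_normc_increment Wf y0 yx x1; rewrite ler_norml; lra.
have : \int[mu]_(y in I01) (normc (f x) ^+ 2 - W12_energy f) <= W12_energy f.
  by apply: le_Rintegral => //; exact: integrable01_cst.
rewrite Rintegral_cst// [X in fine X]lebesgue_measure01 /= mulr1; lra.
Qed.

End Energy.

(** * The Sobolev space as an algebra *)

Section Algebra.
Variable R : realType.
Local Notation mu := (@lebesgue_measure R).
Local Notation I01 := (`[0, 1]%classic : set R).
Implicit Types (f g h phi : R -> R[i]).

Lemma sqr_normcD_le (x y : R[i]) :
  normc (x + y) ^+ 2 <= 2 * normc x ^+ 2 + 2 * normc y ^+ 2.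
Proof.
apply: (@le_trans _ _ ((normc x + normc y) ^+ 2)).
  by rewrite ler_pXn2r ?nnegrE ?addr_ge0 ?normc_ge0// le_normcD.
have := sqr_ge0 (normc x - normc y); nra.
Qed.

Lemma sqr_normcB_le (x y : R[i]) :
  normc (x - y) ^+ 2 <= 2 * normc x ^+ 2 + 2 * normc y ^+ 2.
Proof. by rewrite -(normcN y) sqr_normcD_le. Qed.

Lemma near01 (x : R) : 0 < x < 1 -> \forall y \near x, 0 <= y <= 1.
Proof.
move=> x01; near=> y.
have : y \in `]0, 1[ by near: y; apply: near_in_itvoo; rewrite in_itv.
by rewrite in_itv/= => /andP[y0 y1]; rewrite !ltW.
Unshelve. all: by end_near. Qed.

(** The values outside [0, 1] can change the derivative at the endpoints only, and
    these form a null set. *)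
Lemma W12_eq f g : (forall x, 0 <= x <= 1 -> f x = g x) -> W12 f -> W12 g.
Proof.
move=> fg Wf; have [cf df _] := Wf.
apply: (W12_dominated _ (W12_density_integrable Wf)).
- exact: absolutely_continuous01_eq cf.
- by move=> x _; exact: W12_density_ge0.
- apply: ae_imply2 df (ae_interior01 R) => x dfx x01 Ix.
  have fgx : {near x, f =1 g} by apply: filterS (near01 (x01 Ix)).
  have [dg ->] := near_eq_derivc fgx (dfx Ix).
  by split => //; exact: sqr_normc_derivc_le_density.
Qed.

Lemma W12B f g : W12 f -> W12 g -> W12 (f \- g).
Proof.
move=> Wf Wg; have [cf df _] := Wf; have [cg dg _] := Wg.
apply: (@W12_dominated _ _ (fun x => 2 * W12_density f x + 2 * W12_density g x)).
- exact: absolutely_continuous01B.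
- by apply: integrable01D; apply: integrable01Z; exact: W12_density_integrable.
- by move=> x _; rewrite addr_ge0// mulr_ge0// W12_density_ge0.
- apply: ae_imply2 df dg => x dfx dgx Ix.
  have [dfg ->] := derivablecB (dfx Ix) (dgx Ix); split => //.
  by rewrite (le_trans (sqr_normcB_le _ _))// lerD// ler_wpM2l// sqr_normc_derivc_le_density.
Qed.

Lemma W12_cst (c : R[i]) : W12 (fun=> c).
Proof.
apply: (@W12_dominated _ _ (fun=> 0)).
- exact: absolutely_continuous01_cst.
- exact: integrable01_cst.
- by [].
- apply: aeW => x _; have [dc ->] := derivablec_cst c x.
  by split => //; rewrite normc0 expr0n.
Qed.

(** The numbers stand for [a = E f], [b = E g], [p = |f|^2], [q = |g|^2],
    [r = |f'|^2], [s = |g'|^2] and [e = |(f g)'|^2]. *)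
Let product_density_bound (a b p q r s e : R) : 0 <= p -> 0 <= q -> 0 <= r -> 0 <= s ->
  p <= 2 * a -> q <= 2 * b -> e <= 2 * (r * q) + 2 * (p * s) ->
  p * q + e <= 4 * b * (p + r) + 4 * a * (q + s).
Proof.
move=> p0 q0 r0 s0 pa qb le_e.
have pq : p * q <= p * (2 * b) by rewrite ler_wpM2l.
have rq : r * q <= r * (2 * b) by rewrite ler_wpM2l.
have ps : p * s <= 2 * a * s by rewrite ler_wpM2r.
have pb : 0 <= p * b by rewrite mulr_ge0//; lra.
have qa : 0 <= q * a by rewrite mulr_ge0//; lra.
lra.
Qed.

(** In [(f g)' = f' g + f g'] each undifferentiated factor is replaced by its
    uniform bound, which leaves a combination of the two densities. *)
Lemma W12M f g : W12 f -> W12 g ->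
  W12 (f \* g) /\ W12_energy (f \* g) <= 8 * W12_energy f * W12_energy g.
Proof.
move=> Wf Wg; have [cf df _] := Wf; have [cg dg _] := Wg.
have if_ := W12_density_integrable Wf; have ig := W12_density_integrable Wg.
have [a aE a0] : exists2 a, W12_energy f = a & 0 <= a.
  by exists (W12_energy f) => //; exact: W12_energy_ge0.
have [b bE b0] : exists2 b, W12_energy g = b & 0 <= b.
  by exists (W12_energy g) => //; exact: W12_energy_ge0.
pose w x := 4 * b * W12_density f x + 4 * a * W12_density g x.
have iwf := integrable01Z (4 * b) if_; have iwg := integrable01Z (4 * a) ig.
have iw : mu.-integrable I01 (EFin \o w) by exact: (integrable01D iwf iwg).
have w0 x : 0 <= w x by rewrite /w addr_ge0 ?mulr_ge0 ?W12_density_ge0.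
have key : {ae mu, forall x, I01 x -> derivablec (f \* g) x /\
    W12_density (f \* g) x <= w x}.
  apply: ae_imply2 df dg => x dfx dgx Ix.
  have [dfg dE] := derivablecM (dfx Ix) (dgx Ix); split => //.
  rewrite /W12_density dE /=.
  have x01 : 0 <= x <= 1 by move: Ix; rewrite /= in_itv.
  have F2 := W12_sqr_normc_le Wf x01; have G2 := W12_sqr_normc_le Wg x01.
  have := sqr_normcD_le (derivc f x * g x) (f x * derivc g x).
  rewrite /w /W12_density !normcM !exprMn; rewrite aE in F2; rewrite bE in G2.
  by move=> le_e; apply: (product_density_bound _ _ _ _ F2 G2 le_e); exact: sqr_ge0.
have Wfg : W12 (f \* g).
  apply: (@W12_dominated _ _ w _ iw) => //; first exact: absolutely_continuous01M.
  apply: ae_imply key => x H /H[dfg dw]; split => //.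
  exact: le_trans (sqr_normc_derivc_le_density _ _) dw.
split => //.
have mfg : measurable_fun I01 (W12_density (f \* g)).
  by apply/measurable_EFinP; case/integrableP: (W12_density_integrable Wfg).
have dw : {ae mu, forall x, I01 x -> W12_density (f \* g) x <= w x}.
  by apply: ae_imply key => x H /H[].
have [_ /le_trans] := integrable01_ae_bound mfg
  (fun x _ => W12_density_ge0 _ x) (fun x _ => w0 x) dw iw.
apply.
rewrite /w (RintegralD _ iwf iwg)// (RintegralZl _ _ if_)// (RintegralZl _ _ ig)//.
rewrite -/(W12_energy f) -/(W12_energy g) aE bE.
by rewrite le_eqVlt; apply/orP; left; apply/eqP; ring.
Qed.

(** The derivative of the inverse comes from differentiating [g^-1 * g = 1], once
    [g^-1] is known to be derivable. *)
Lemma W12V g (c : R) : W12 g -> 0 < c ->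
  (forall x, 0 <= x <= 1 -> c <= normc (g x)) -> W12 (fun x => (g x)^-1).
Proof.
move=> Wg c0 cg; have [acg dg _] := Wg.
have g0 x : 0 <= x <= 1 -> g x != 0.
  by move=> /cg; apply: contraTneq => ->; rewrite normc0 -ltNge.
apply: (@W12_dominated _ _ (fun x => c ^- 4 * W12_density g x)).
- exact: absolutely_continuous01V cg.
- by apply: integrable01Z; exact: W12_density_integrable.
- by move=> x _; rewrite mulr_ge0 ?W12_density_ge0// invr_ge0 exprn_ge0// ltW.
- apply: ae_imply2 dg (ae_interior01 R) => x dgx x01 Ix.
  have {}dgx := dgx Ix; have {}x01 := x01 Ix.
  have gx0 : g x != 0 by apply: g0; case/andP: x01 => x0 x1; rewrite !ltW.
  have dV := derivablecV gx0 dgx; split => //.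
  have [_ dE] := derivablecM dV dgx.
  have /near_eq_derivc : {near x, (fun=> 1) =1 (fun y => (g y)^-1) \* g}.
    by apply: filterS (near01 x01) => y y01 /=; rewrite mulVf// g0.
  have [d1 d1E] := derivablec_cst (1 : R[i]) x.
  move=> /(_ d1)[_]; rewrite d1E dE => /eqP.
  rewrite addr_eq0 => /eqP E.
  have -> : derivc (fun y => (g y)^-1) x = - ((g x)^-1 * derivc g x) * (g x)^-1.
    by rewrite -E mulfK.
  rewrite normcM normcN normcM normcV mulrAC exprMn.
  apply: ler_pM; rewrite ?sqr_ge0 ?sqr_normc_derivc_le_density//.
  rewrite -expr2 -exprM exprVn lef_pV2 ?posrE ?exprn_gt0//.
    by rewrite ler_pXn2r ?nnegrE ?normc_ge0 ?(ltW c0)// cg//;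
      case/andP: x01 => x0 x1; rewrite !ltW.
  by rewrite (lt_le_trans c0)// cg//; case/andP: x01 => x0 x1; rewrite !ltW.
Qed.

End Algebra.

(** * Densely defined multipliers *)

Theorem theorem2p2 (R : realType) (phi : R -> R[i]) :
  (densely_defined_multiplier phi <-> W12 phi) /\
  (densely_defined_multiplier phi ->
    multiplier_dom phi = W12 /\
    exists2 C : R, 0 <= C &
      forall f : R -> R[i], W12 f -> W12_norm (phi \* f) <= C * W12_norm f).
Proof.
have dense_W12 : densely_defined_multiplier phi -> W12 phi.
  move=> dense; have W1 := W12_cst (1 : R[i]).
  (* With distance below 1/4 to the constant 1, the uniform bound gives
     [|1 - g|^2 <= 2/16 < 1/4]. *)
  have e0 : (0 : R) < 1 / 4 by [].
  have [g [Wg Wpg] ge] := dense _ W1 _ e0.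
  have Wd := W12B W1 Wg.
  have g_far x : 0 <= x <= 1 -> 1 / 2 <= normc (g x).
    move=> x01; have := W12_sqr_normc_le Wd x01.
    have E0 := W12_energy_ge0 ((fun=> 1) \- g).
    have : W12_energy ((fun=> 1) \- g) < (1 / 4) ^+ 2.
      rewrite -[ltLHS]sqr_sqrtr// -W12_normE ltr_pXn2r ?nnegrE//.
      by rewrite W12_normE sqrtr_ge0.
    move=> lt_e le_n; have : normc (1 - g x) ^+ 2 < (1 / 2) ^+ 2.
      by apply: le_lt_trans le_n _; rewrite !expr2 in lt_e *; lra.
    rewrite ltr_pXn2r ?nnegrE ?normc_ge0//.
    have := le_normcD (1 - g x) (g x); rewrite subrK normc1; lra.
  have half0 : (0 : R) < 1 / 2 by [].
  have [Wphi _] := W12M Wpg (W12V Wg half0 g_far).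
  apply: W12_eq Wphi => x x01 /=; rewrite mulfK//.
  by apply: contraTneq (g_far _ x01) => ->; rewrite normc0 -ltNge.
have W12_dense : W12 phi -> densely_defined_multiplier phi.
  move=> Wphi f Wf e e0; exists f; first exact: (conj Wf (W12M Wphi Wf).1).
  have -> : f \- f = (fun=> 0) by apply/funext => x /=; rewrite subrr.
  rewrite W12_normE /W12_energy (_ : \int[_]_(x in _) _ = 0) ?sqrtr0//.
  rewrite /Rintegral integral0_eq// => x _; rewrite /W12_density.
  by have [_ ->] := derivablec_cst (0 : R[i]) x; rewrite normc0 expr0n addr0.
split; first by split.
move=> /dense_W12 Wphi; split.
  apply/seteqP; split => f; first by case=> Wf _; exact: Wf.
  move=> Wf;   exact: (conj Wf (W12M Wphi Wf).1).
exists (Num.sqrt (8 * W12_energy phi)); first exact: sqrtr_ge0.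
move=> f Wf; rewrite !W12_normE -sqrtrM; last first.
  by rewrite mulr_ge0 ?W12_energy_ge0.
apply: ler_wsqrtr.
exact: (W12M Wphi Wf).2.
Qed.
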